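(* For any positive integer $m$, the number $N(G_2,m)$ is given by $$N(G_2,m)=\begin{cases}(m^2+6m+12)/12 & m\equiv 0 \pmod 6,\\ (m^2+6m+5)/12 & m\equiv\pm1\pmod 6,\\ (m^2+6m+8)/12 & m\equiv\pm2\pmod 6,\\ (m^2+6m+9)/12 & m\equiv3\pmod 6.\end{cases}$$
   Context: $G_2$ denotes the complex connected simply-connected simple Lie group of type $G_2$. For a positive integer $m$, $N(G,m)$ denotes the number of conjugacy classes of $G$ contained in $\{x\in G: x^m=1\}$, i.e. the number of conjugacy classes of elements whose order divides $m$. *)

(* Defs.v *)
From HB Require Import structures.
From mathcomp Require Import all_boot all_order all_algebra.
From mathcomp Require Import finmap boolp classical_sets cardinality reals.
From mathcomp Require Import complex ring.

Set Implicit Arguments.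
Unset Strict Implicit.
Unset Printing Implicit Defensive.

Import GRing.Theory.

Local Open Scope ring_scope.

Section Octonions.
Variable F : fieldType.

Definition dot3 (u v : 'rV[F]_3) : F := (u *m v^T) 0 0.

Definition cross3 (u v : 'rV[F]_3) : 'rV[F]_3 :=
  \row_(i < 3) (u 0 (i + 1) * v 0 (i + 2%:R) - u 0 (i + 2%:R) * v 0 (i + 1)).

(* The split octonion algebra over F, as Zorn's vector matrices: the quadruple
   (a, u, v, b) stands for the "matrix" with rows (a, u) and (v, b).
   Over an algebraically closed F it is the only octonion algebra; over the
   complex numbers it is the complexification of Cayley's octonions. *)
Notation oct := (F^o * 'rV[F]_3 * 'rV[F]_3 * F^o)%type.

Definition oct_mul (x y : oct) : oct :=
  let: (a, u, v, b) := x in let: (a', u', v', b') := y in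
  (a * a' + dot3 u v',
   a *: u' + b' *: u - cross3 v v',
   a' *: v + b *: v' + cross3 u u',
   b * b' + dot3 v u').

Definition oct_one : oct := (1, 0, 0, 1).

Definition oct_norm (x : oct) : F :=
  let: (a, u, v, b) := x in a * b - dot3 u v.

Lemma dot3E (u v : 'rV[F]_3) :
  dot3 u v = u 0 0 * v 0 0 + u 0 1 * v 0 1 + u 0 2%:R * v 0 2%:R.
Proof.
rewrite /dot3 mxE !big_ord_recl big_ord0 addr0 !mxE addrA.
by congr (_ * _ + _ * _ + _ * _); congr (_ 0 _); apply: val_inj.
Qed.

Lemma cross3E (u v : 'rV[F]_3) :
  ((cross3 u v 0 0 = u 0 1 * v 0 2%:R - u 0 2%:R * v 0 1) *
   (cross3 u v 0 1 = u 0 2%:R * v 0 0 - u 0 0 * v 0 2%:R) *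
   (cross3 u v 0 2%:R = u 0 0 * v 0 1 - u 0 1 * v 0 0))%type.
Proof.
by split; [split|]; rewrite mxE;
  congr (_ * _ - _ * _); congr (_ 0 _); apply: val_inj.
Qed.

Lemma oct_mul1x : left_id oct_one oct_mul.
Proof.
move=> [[[a u] v] b]; rewrite /oct_mul /=; congr (_, _, _, _).
- by rewrite dot3E !mxE; ring.
- by apply/rowP => i; rewrite !mxE; ring.
- by apply/rowP => i; rewrite !mxE; ring.
- by rewrite dot3E !mxE; ring.
Qed.

Lemma oct_mulx1 : right_id oct_one oct_mul.
Proof.
move=> [[[a u] v] b]; rewrite /oct_mul /=; congr (_, _, _, _).
- by rewrite dot3E !mxE; ring.
- by apply/rowP => i; rewrite !mxE; ring.
- by apply/rowP => i; rewrite !mxE; ring.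
- by rewrite dot3E !mxE; ring.
Qed.

(* This is what makes the 8-dimensional algebra above an octonion algebra. *)
Lemma oct_normM : {morph oct_norm : x y / oct_mul x y >-> x * y}.
Proof.
move=> [[[a u] v] b] [[[a' u'] v'] b']; rewrite /oct_norm /oct_mul.
have E (p q r : 'rV[F]_3) (s t : F) i :
  (s *: p + t *: q - r) 0 i = s * p 0 i + t * q 0 i - r 0 i by rewrite !mxE.
have E' (p q r : 'rV[F]_3) (s t : F) i :
  (s *: p + t *: q + r) 0 i = s * p 0 i + t * q 0 i + r 0 i by rewrite !mxE.
by rewrite !dot3E !E !E' !cross3E; ring.
Qed.

Definition oct_autb : pred 'End(oct) := fun f =>
  (lker f == 0%VS) && `[< {morph f : x y / oct_mul x y} >].

(* An injective endomorphism of the finite-dimensional space oct is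
   bijective, so these are the F-algebra automorphisms. *)
Record oct_aut := OctAut { oct_aut_val :> 'End(oct); _ : oct_autb oct_aut_val }.

HB.instance Definition _ := [isSub for oct_aut_val].
HB.instance Definition _ := [Choice of oct_aut by <:].

Lemma oct_aut1_subproof : oct_autb \1%VF.
Proof.
apply/andP; split; last by apply/asboolP => x y; rewrite !lfunE.
by apply/lker0P => x y; rewrite !lfunE.
Qed.
Definition oct_aut1 := OctAut oct_aut1_subproof.

Lemma oct_autM_subproof (f g : oct_aut) : oct_autb (f \o g)%VF.
Proof.
have /andP[/lker0P f0 /asboolP fM] := valP f.
have /andP[/lker0P g0 /asboolP gM] := valP g.
apply/andP; split; last by apply/asboolP => x y; rewrite /= !lfunE /= gM fM.
by apply/lker0P => x y; rewrite /= !lfunE => /f0/g0.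
Qed.
Definition oct_autM f g := OctAut (oct_autM_subproof f g).

Lemma oct_autV_subproof (f : oct_aut) : oct_autb (f^-1)%VF.
Proof.
have /andP[f0 /asboolP fM] := valP f.
have fVK x : f (f^-1%VF x) = x by rewrite -comp_lfunE lker0_compfV // id_lfunE.
apply/andP; split; first by apply/lker0P; apply: can_inj fVK.
apply/asboolP => x y.
by apply: (can_inj (lker0_lfunK f0)); rewrite fM !fVK.
Qed.
Definition oct_autV f := OctAut (oct_autV_subproof f).

Lemma oct_autMA : associative oct_autM.
Proof. by move=> f g h; apply: val_inj; apply: comp_lfunA. Qed.
Lemma oct_autM1x : left_id oct_aut1 oct_autM.
Proof. by move=> f; apply: val_inj; apply: comp_lfun1l. Qed.
Lemma oct_autMx1 : right_id oct_aut1 oct_autM.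
Proof. by move=> f; apply: val_inj; apply: comp_lfun1r. Qed.
Lemma oct_autMVx : left_inverse oct_aut1 oct_autV oct_autM.
Proof.
by move=> f; apply: val_inj; apply: lker0_compVf; case/andP: (valP f).
Qed.
Lemma oct_autMxV : right_inverse oct_aut1 oct_autV oct_autM.
Proof.
by move=> f; apply: val_inj; apply: lker0_compfV; case/andP: (valP f).
Qed.

HB.instance Definition _ := isGroup.Build oct_aut
  oct_autMA oct_autM1x oct_autMx1 oct_autMVx oct_autMxV.

End Octonions.

(* The complex connected simply-connected simple Lie group of type G_2,
   realised as the automorphism group of the complex octonions. *)
Definition G2 (R : realType) : groupType := oct_aut R[i].

Section CountingClasses.
Local Open Scope classical_set_scope.
Variable G : groupType.

Definition conj_class (x : G) : set G := [set (x ^ g)%g | g in [set: G]].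

Definition torsion_classes (m : nat) : set (set G) :=
  [set K | (exists x, K = conj_class x) /\ K `<=` [set x | (x ^+ m = 1)%g]].

(* fset_set sends infinite sets to the empty fset, so this number is only
   meaningful when torsion_classes m is finite. *)
Definition num_torsion_classes (m : nat) : nat :=
  #|` fset_set (torsion_classes m)|.

End CountingClasses.

Arguments torsion_classes : clear implicits.
Arguments num_torsion_classes : clear implicits.

(* Main.v *)
From HB Require Import structures.
Require Import Defs.
From mathcomp Require Import all_boot all_order all_algebra.
From mathcomp Require Import fingroup perm cyclic separable cyclotomic.
From mathcomp Require Import boolp classical_sets cardinality reals.
From mathcomp Require Import finmap complex ring zify.

(** Write the octonions as quadruples x = (a, u, v, b), with u and v vectors of
    dimension 3, and let e = (1, 0, 0, 0).

    Conjugacy classes in G2 of elements of order dividing m correspond to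
    partitions of m into at most three parts: with z a primitive m-th root of
    unity, the partition a >= b >= c >= 0 of m corresponds to the class of the
    diagonal automorphism which multiplies the coordinates of u by z^a, z^b,
    z^c and those of v by their inverses.  The stated formulas are the
    classical count of these partitions ([size_partitions3E]).

    Every f with f^m = 1 is conjugate to a diagonal automorphism
    ([similar_torus]).  The key is that f fixes a nontrivial idempotent: f has
    an isotropic eigenvector x ([isotropic_eigenvector]), it has y of inverse
    eigenvalue with tr (x y) <> 0, and x y is then fixed, of norm 0 and nonzero
    trace ([fixed_idem_of_isotropic]).  All nontrivial idempotents are in the
    orbit of e ([oct_e_transitive]), shown with explicit unipotent
    automorphisms, and the stabiliser of e is SL3 ([stab_oct_e]), where
    elements of finite order are diagonalizable.

    The exponents of a diagonal automorphism, taken in [0, m), add up to 0, m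
    or 2 m.  Permuting the coordinates and inverting, which are conjugations in
    G2, brings them to a partition of m ([similar_torus_exp]).  Distinct
    partitions give non-conjugate automorphisms because the eight eigenvalues,
    with multiplicity, determine the partition ([partitions3_inj]). *)

Set Implicit Arguments.
Unset Strict Implicit.
Unset Printing Implicit Defensive.

Import Order.TTheory GRing.Theory Num.Theory.

Local Open Scope ring_scope.

Local Notation oct F := (F^o * 'rV[F]_3 * 'rV[F]_3 * F^o)%type.

(** * Coordinates *)

Section Coordinates.
Variable F : fieldType.
Implicit Types u v : 'rV[F]_3.

Lemma ord3P (p : 'I_3 -> Prop) : p 0 -> p 1 -> p 2%:R -> forall i, p i.
Proof.
move=> p0 p1 p2 [[|[|[|//]]] i3].
- by rewrite (_ : Ordinal i3 = 0) //; apply: val_inj.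
- by rewrite (_ : Ordinal i3 = 1) //; apply: val_inj.
- by rewrite (_ : Ordinal i3 = 2%:R) //; apply: val_inj.
Qed.

Lemma row3P u v :
  u 0 0 = v 0 0 -> u 0 1 = v 0 1 -> u 0 2%:R = v 0 2%:R -> u = v.
Proof. by move=> e0 e1 e2; apply/rowP; apply: ord3P. Qed.

Lemma rowD u v i : (u + v) 0 i = u 0 i + v 0 i. Proof. by rewrite mxE. Qed.
Lemma rowN u i : (- u) 0 i = - u 0 i. Proof. by rewrite mxE. Qed.
Lemma rowZ a u i : (a *: u) 0 i = a * u 0 i. Proof. by rewrite mxE. Qed.
Lemma row_0 i : (0 : 'rV[F]_3) 0 i = 0. Proof. by rewrite mxE. Qed.
Definition row3E := (rowD, rowN, rowZ, row_0, dot3E, cross3E).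

End Coordinates.

Local Ltac octonion_ring :=
  congr (_, _, _, _) => /=;
  by [rewrite ?row3E; ring | apply: row3P; rewrite !row3E; ring].

(** * Explicit automorphisms of the split octonions *)

Section Automorphisms.
Variable F : fieldType.
Implicit Types (u v w : 'rV[F]_3) (x y z : oct F) (f g h : oct_aut F).

(** It normalises the diagonal torus and acts on it by inversion. *)
Definition swap_fun (x : oct F) : oct F :=
  let: (a, u, v, b) := x in (b, - v, - u, a).

(** The exponential of the derivation
    (a, u, v, b) |-> (w.v, (b - a) w, - w x u, - w.v), whose cube is zero;
    its square sends (a, u, v, b) to (0, -2 (w.v) w, 0, 0). *)
Definition shear_fun w (x : oct F) : oct F :=
  let: (a, u, v, b) := x in
  (a + dot3 w v, u + (b - a - dot3 w v) *: w, v - cross3 w u, b - dot3 w v).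

(** For P in SL3 and Q its contragredient these maps form the subgroup SL3
    of G2 which fixes the idempotent (1, 0, 0, 0). *)
Definition block_fun (P Q : 'M[F]_3) (x : oct F) : oct F :=
  let: (a, u, v, b) := x in (a, u *m P, v *m Q, b).

Lemma octZD k (a b a' b' : F) u v u' v' :
  k *: ((a, u, v, b) : oct F) + ((a', u', v', b') : oct F) =
  (k * a + a', k *: u + u', k *: v + v', k * b + b').
Proof. by []. Qed.

Lemma octZ k (a b : F) u v :
  k *: ((a, u, v, b) : oct F) = (k * a, k *: u, k *: v, k * b).
Proof. by []. Qed.

Lemma swap_fun_linear : linear swap_fun.
Proof.
move=> k [[[a u] v] b] [[[a' u'] v'] b']; rewrite octZD /swap_fun octZD.
by congr (_, _, _, _); apply: row3P; rewrite !row3E; ring.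
Qed.

Lemma swap_funM x y : swap_fun (oct_mul x y) = oct_mul (swap_fun x) (swap_fun y).
Proof.
move: x y => [[[a u] v] b] [[[a' u'] v'] b'] /=; octonion_ring.
Qed.

Lemma swap_funK : involutive swap_fun.
Proof. by move=> [[[a u] v] b] /=; rewrite !opprK. Qed.

Lemma shear_fun_linear w : linear (shear_fun w).
Proof.
move=> k [[[a u] v] b] [[[a' u'] v'] b']; rewrite octZD /shear_fun octZD.
octonion_ring.
Qed.

Lemma shear_funM w x y :
  shear_fun w (oct_mul x y) = oct_mul (shear_fun w x) (shear_fun w y).
Proof.
move: x y => [[[a u] v] b] [[[a' u'] v'] b'] /=; octonion_ring.
Qed.

Lemma shear_funK w : cancel (shear_fun w) (shear_fun (- w)).
Proof.
move=> [[[a u] v] b] /=; octonion_ring.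
Qed.

Lemma block_fun_linear P Q : linear (block_fun P Q).
Proof.
move=> k [[[a u] v] b] [[[a' u'] v'] b']; rewrite octZD /block_fun octZD.
by rewrite !mulmxDl -!scalemxAl.
Qed.

(** The scalar triple product as a determinant: it turns the behaviour of the
    cross product under matrices into multiplicativity of the determinant. *)
Lemma det_cross3 (P : 'M[F]_3) :
  \det P = dot3 (cross3 (row 0 P) (row 1 P)) (row 2%:R P).
Proof.
pose p (i j : nat) := P (inord i) (inord j).
have E i j : P i j = p i j by rewrite /p !inord_val.
rewrite (expand_det_row _ 0) !big_ord_recl big_ord0 /cofactor.
rewrite !(expand_det_row _ 0) !big_ord_recl !big_ord0 /cofactor !det_mx11.
by rewrite !row3E !mxE !E /=; ring.
Qed.

Lemma dot3_mul u v (P : 'M[F]_3) : dot3 (u *m P) v = dot3 u (v *m P^T).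
Proof. by rewrite /dot3 trmx_mul trmxK mulmxA. Qed.

Lemma dot3C u v : dot3 u v = dot3 v u.
Proof. by rewrite !row3E; ring. Qed.

Lemma dot3_inj u v : (forall w, dot3 u w = dot3 v w) -> u = v.
Proof.
move=> e; apply/rowP => i; have := e (delta_mx 0 i).
have E w : dot3 w (delta_mx 0 i) = w 0 i.
  rewrite /dot3 trmx_delta mxE (bigD1 i) //= big1 ?addr0 ?mxE ?eqxx ?mulr1 //.
  by move=> j /negbTE ne; rewrite mxE ne mulr0.
by rewrite !E.
Qed.

Lemma dot3_cross3_mul u v w (P : 'M[F]_3) :
  dot3 (cross3 (u *m P) (v *m P)) (w *m P) = \det P * dot3 (cross3 u v) w.
Proof.
pose M (u v w : 'rV[F]_3) : 'M[F]_3 :=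
  \matrix_(i < 3) (if i == 0 then u else if i == 1 then v else w).
have dM u1 v1 w1 : \det (M u1 v1 w1) = dot3 (cross3 u1 v1) w1.
  by rewrite det_cross3 !rowK.
rewrite -!dM mulrC -det_mulmx; congr (\det _); apply/row_matrixP => i.
by rewrite row_mul !rowK; case: ifP => // _; case: ifP.
Qed.

(** Pairing with w P reduces this to [dot3_cross3_mul]; the pairing is perfect
    and P is invertible. *)
Lemma cross3_mul u v (P Q : 'M[F]_3) :
  \det P = 1 -> P *m Q^T = 1%:M -> cross3 (u *m P) (v *m P) = cross3 u v *m Q.
Proof.
move=> dP PQ; apply: dot3_inj => w.
have QP : Q^T *m P = 1%:M by rewrite mulmx1C.
rewrite -[w]mulmx1 -QP mulmxA dot3_cross3_mul dP mul1r -mulmxA QP mulmx1.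
by rewrite dot3_mul.
Qed.

Lemma contragredientC (P Q : 'M[F]_3) : P *m Q^T = 1%:M -> Q *m P^T = 1%:M.
Proof. by move=> PQ; rewrite -[Q]trmxK -trmx_mul PQ trmx1. Qed.

Lemma block_funM P Q x y : \det P = 1 -> P *m Q^T = 1%:M ->
  block_fun P Q (oct_mul x y) = oct_mul (block_fun P Q x) (block_fun P Q y).
Proof.
move=> dP PQ; have QP := contragredientC PQ.
have dQ : \det Q = 1.
  by have := congr1 determinant QP; rewrite det_mulmx det_tr dP mulr1 det1.
move: x y => [[[a u] v] b] [[[a' u'] v'] b'] /=; congr (_, _, _, _) => /=.
- by rewrite dot3_mul -mulmxA QP mulmx1.
- by rewrite mulmxBl mulmxDl -!scalemxAl (cross3_mul _ _ dQ QP).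
- by rewrite !mulmxDl -!scalemxAl (cross3_mul _ _ dP PQ).
- by rewrite dot3_mul -mulmxA PQ mulmx1.
Qed.

Lemma block_funK P Q : P *m Q^T = 1%:M -> cancel (block_fun P Q) (block_fun Q^T P^T).
Proof.
move=> PQ [[[a u] v] b] /=; rewrite -!mulmxA PQ contragredientC //.
by rewrite !mulmx1.
Qed.

(** Packages a map given by a formula as an element of the group. *)
Lemma oct_aut_of (f : oct F -> oct F) : linear f ->
  {morph f : x y / oct_mul x y} -> injective f ->
  exists g : oct_aut F, g =1 f.
Proof.
move=> fL fM fI.
pose fl := GRing.isLinear.Build F (oct F) (oct F) *:%R f fL.
pose f' : {linear oct F -> oct F} := HB.pack f fl.
have E x : linfun f' x = f x by rewrite lfunE.
have p : oct_autb (linfun f').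
  apply/andP; split; first by apply/lker0P => x y; rewrite !E => /fI.
  by apply/asboolP => x y; rewrite !E fM.
by exists (OctAut p) => x; rewrite /= E.
Qed.

Lemma aut_morph f : {morph f : x y / oct_mul x y}.
Proof. by case/andP: (valP f) => _ /asboolP. Qed.

Lemma aut_inj f : injective f.
Proof. by case/andP: (valP f) => /lker0P. Qed.

Lemma aut_mulE f g x : (f * g)%g x = f (g x).
Proof. exact: comp_lfunE. Qed.

Lemma aut_1E x : (1%g : oct_aut F) x = x.
Proof. exact: id_lfunE. Qed.

Lemma aut_VK f : cancel (f^-1)%g f.
Proof. by move=> x; rewrite -aut_mulE mulgV aut_1E. Qed.

Lemma aut_expE f n x : (f ^+ n)%g x = iter n f x.
Proof. by elim: n => [|n IH]; rewrite ?expg0 ?aut_1E // expgS aut_mulE IH. Qed.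

Lemma aut_K f : cancel f (f^-1)%g.
Proof. by move=> x; rewrite -aut_mulE mulVg aut_1E. Qed.

Lemma aut_ext f g : f =1 g -> f = g.
Proof. by move=> e; apply: val_inj; apply/lfunP. Qed.

(** Conjugacy, in the orientation that avoids inverses. *)
Definition similar f g := exists h : oct_aut F, forall x, h (f x) = g (h x).

Lemma similar_refl f : similar f f.
Proof. by exists 1%g => x; rewrite !aut_1E. Qed.

Lemma similar_sym f g : similar f g -> similar g f.
Proof.
by move=> [h hE]; exists (h^-1)%g => x; apply: (aut_inj (f := h)); rewrite hE !aut_VK.
Qed.

Lemma similar_trans f g h : similar f g -> similar g h -> similar f h.
Proof.
by move=> [k kE] [l lE]; exists (l * k)%g => x; rewrite !aut_mulE kE lE.
Qed.

Lemma conj_class_similar f g : conj_class f g <-> similar f g.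
Proof.
split=> [[k _ <-]|[k kE]].
  by exists (k^-1)%g => x; rewrite conjgE !aut_mulE aut_VK.
exists (k^-1)%g => //; apply: aut_ext => x.
by rewrite conjgE !aut_mulE invgK kE aut_VK.
Qed.

Lemma conj_classP f g : conj_class f = conj_class g <-> similar f g.
Proof.
split=> [e|fg].
  by apply/conj_class_similar; rewrite e; apply/conj_class_similar/similar_refl.
apply/seteqP; split=> h /conj_class_similar s; apply/conj_class_similar.
  exact: similar_trans (similar_sym fg) s.
exact: similar_trans fg s.
Qed.

Definition oct_tr (x : oct F) : F := let: (a, _, _, b) := x in a + b.

Lemma aut_oct_one f : f (oct_one F) = oct_one F.
Proof.
rewrite -[LHS]oct_mulx1 -{2}(aut_VK f (oct_one F)) -aut_morph oct_mul1x.
exact: aut_VK.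
Qed.

Lemma oct_sqr x : oct_mul x x = oct_tr x *: x - oct_norm x *: (oct_one F : oct F).
Proof.
move: x => [[[a u] v] b]; rewrite -scaleNr addrC [oct_tr _ *: _]octZ octZD /=.
octonion_ring.
Qed.

(** The square of f x is given by [oct_sqr] for f x, and also by the image
    under f of [oct_sqr] for x, so (tr (f x) - tr x) f x is a multiple of 1.
    Unless the traces agree, f x is thus a scalar, and f x = x as f fixes
    the scalars. *)
Lemma aut_tr_norm f x : oct_tr (f x) = oct_tr x /\ oct_norm (f x) = oct_norm x.
Proof.
have E : (oct_tr (f x) - oct_tr x) *: f x =
         (oct_norm (f x) - oct_norm x) *: (oct_one F : oct F).
  have := oct_sqr (f x); rewrite -aut_morph oct_sqr linearB !linearZ /= aut_oct_one.
  move/esym/eqP; rewrite !scalerN subr_eq => /eqP e; rewrite !scalerBl e.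
  by rewrite addrAC [X in X - _ + _]addrC addrK addrC.
case: (eqVneq (oct_tr (f x)) (oct_tr x)) => [e|ne].
  split=> //; move: E; rewrite e subrr scale0r => /esym/eqP.
  by rewrite scaler_eq0 subr_eq0 => /orP[/eqP //|/eqP[/eqP]]; rewrite oner_eq0.
suff -> : f x = x by [].
have {}E : f x = (oct_tr (f x) - oct_tr x)^-1 *:
    ((oct_norm (f x) - oct_norm x) *: (oct_one F : oct F)).
  by rewrite -E scalerA mulVf ?scale1r // subr_eq0.
move: E; set c := _^-1; set d := (_ - _) => E.
suff e : x = c *: (d *: (oct_one F : oct F)) by rewrite E -e.
by apply: (aut_inj (f := f)); rewrite !linearZ /= aut_oct_one.
Qed.

Lemma aut_tr f x : oct_tr (f x) = oct_tr x.
Proof. by case: (aut_tr_norm f x). Qed.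

Lemma aut_norm f x : oct_norm (f x) = oct_norm x.
Proof. by case: (aut_tr_norm f x). Qed.

End Automorphisms.

(** * Idempotents and their stabilisers *)

Section Idempotents.
Variable F : fieldType.
Implicit Types (u v w : 'rV[F]_3) (x y z : oct F) (f g h : oct_aut F).

Definition oct_e : oct F := (1, 0, 0, 0).

Lemma aut_block (P Q : 'M[F]_3) : \det P = 1 -> P *m Q^T = 1%:M ->
  exists g : oct_aut F, g =1 block_fun P Q.
Proof.
move=> dP PQ; apply: oct_aut_of; first exact: block_fun_linear.
  by move=> x y; apply: block_funM.
exact: can_inj (block_funK PQ).
Qed.

(** The elements of trace 1 and norm 0 are the nontrivial idempotents.  A shear
    first makes the diagonal (1, 0); then u and v are orthogonal, and two more
    shears, by u and, after a swap, by v, remove them. *)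
Lemma oct_e_transitive x : oct_tr x = 1 -> oct_norm x = 0 ->
  exists g : oct_aut F, g x = oct_e.
Proof.
pose good x := exists g : oct_aut F, g x = oct_e.
have good_aut y (f : oct F -> oct F) : linear f ->
    {morph f : x y / oct_mul x y} -> injective f -> good (f y) -> good y.
  move=> fL fM fI [g gE]; have [k kE] := oct_aut_of fL fM fI.
  by exists (g * k)%g; rewrite aut_mulE kE.
have good_swap y : good (swap_fun y) -> good y.
  apply: good_aut; first exact: swap_fun_linear; first exact: swap_funM.
  exact: can_inj (@swap_funK F).
have good_shear w y : good (shear_fun w y) -> good y.
  apply: good_aut; first exact: shear_fun_linear; first exact: shear_funM.
  exact: can_inj (shear_funK w).
have good1 : good (1, 0, 0, 0) by exists 1%g; rewrite aut_1E.
have good0 : good (0, 0, 0, 1) by apply: good_swap; rewrite /= oppr0.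
have goodv v : good (1, 0, v, 0).
  apply/good_swap/(good_shear v); rewrite /= oppr0.
  rewrite (_ : (_, _, _, _) = (0, 0, 0, 1)) //.
  octonion_ring.
have gooduv u v : dot3 u v = 0 -> good (1, u, v, 0).
  move=> uv; apply: (good_shear u); rewrite /= uv.
  rewrite (_ : (_, _, _, _) = (1, 0, v, 0)) //.
  congr (_, _, _, _); by [ring|apply: row3P; rewrite !row3E; ring].
have good_nz a u v b : a + b = 1 -> a * b - dot3 u v = 0 -> v != 0 -> good (a, u, v, b).
  move=> ab1 n0 /eqP v0.
  have [i vi] : exists i, v 0 i != 0.
    apply: contrapT => /forallNP e; apply: v0; apply/rowP => i; rewrite mxE.
    by apply/eqP; apply: contrapT; move/negP; exact: e.
  (* A shear adds w.v to a; w is chosen so that w.v = 1 - a = b. *)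
  pose w := ((1 - a) / v 0 i) *: delta_mx 0 i : 'rV[F]_3.
  have wv : dot3 w v = b.
    rewrite /dot3 -scalemxAl -rowE !mxE divfK //.
    by rewrite -ab1 addrC addKr.
  have := gooduv (u + (b - a - dot3 w v) *: w) (v - cross3 w u).
  have -> : dot3 (u + (b - a - dot3 w v) *: w) (v - cross3 w u) =
            dot3 u v + (b - a - dot3 w v) * dot3 w v by rewrite !row3E; ring.
  rewrite wv -(subr0_eq n0) => gd.
  apply: (good_shear w); rewrite /= wv subrr ab1; apply: gd; ring.
move: x => [[[a u] v] b] ab1 n0; have [v0|] := eqVneq v 0; last exact: good_nz.
have [u0|u0] := eqVneq u 0; last first.
  apply: good_swap => /=; apply: good_nz; last by rewrite oppr_eq0.
    by rewrite addrC.
  by rewrite -n0 /= !row3E; ring.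
move: ab1 n0; rewrite u0 v0 /= !row3E => ab1.
have -> : a * b - (0 * 0 + 0 * 0 + 0 * 0) = a * b by ring.
move/eqP; rewrite mulf_eq0 => /orP[] /eqP z; move: ab1; rewrite z ?addr0 ?add0r => ->.
  exact: good0.
exact: good1.
Qed.

Lemma oct_e_mull (a b : F) u v : oct_mul oct_e (a, u, v, b) = (a, u, 0, 0).
Proof.
rewrite /=; octonion_ring.
Qed.

Lemma oct_e_mulr (a b : F) u v : oct_mul (a, u, v, b) oct_e = (a, 0, v, 0).
Proof.
rewrite /=; octonion_ring.
Qed.

Lemma octD (a b a' b' : F) u v u' v' :
  ((a, u, v, b) : oct F) + ((a', u', v', b') : oct F) =
  (a + a', u + u', v + v', b + b').
Proof. by []. Qed.

Definition octu u : oct F := (0, u, 0, 0).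
Definition octv v : oct F := (0, 0, v, 0).

(** The elements (0, u, 0, 0) are the x with e x = x and x e = 0, so an
    automorphism fixing e maps the space of these to itself. *)
Lemma stab_e_u f : f oct_e = oct_e ->
  exists P : 'M_3, forall u, f (octu u) = octu (u *m P).
Proof.
move=> fe; pose fu u : 'rV[F]_3 := (f (octu u)).1.1.2.
have E u : f (octu u) = octu (fu u).
  have := oct_e_mull 0 0 u 0; have := oct_e_mulr 0 0 u 0.
  rewrite -/(octu u) => /(congr1 f) + /(congr1 f).
  rewrite !aut_morph fe /fu; case: (f (octu u)) => [[[a u'] v'] b].
  rewrite (_ : (0, 0, 0, 0) = 0 :> oct F) // linear0.
  rewrite oct_e_mull oct_e_mulr => /(congr1 (fun z : oct F => (z.1.1.1, z.1.2))).
  by move=> /= [-> ->] /(congr1 (fun z : oct F => z.2)) /= <-.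
have fuL : linear fu.
  move=> k u v; rewrite /fu (_ : octu _ = k *: octu u + octu v) ?linearP //.
  by rewrite octZD !mulr0 !scaler0 !addr0.
pose fl := GRing.isLinear.Build F 'rV[F]_3 'rV[F]_3 *:%R fu fuL.
pose f' : {linear 'rV[F]_3 -> 'rV[F]_3} := HB.pack fu fl.
by exists (lin1_mx f') => u; rewrite mul_rV_lin1 E.
Qed.

(** Here the characterisation is e x = 0 and x e = x. *)
Lemma stab_e_v f : f oct_e = oct_e ->
  exists Q : 'M_3, forall v, f (octv v) = octv (v *m Q).
Proof.
move=> fe; pose fu u : 'rV[F]_3 := (f (octv u)).1.2.
have E u : f (octv u) = octv (fu u).
  have := oct_e_mull 0 0 0 u; have := oct_e_mulr 0 0 0 u.
  rewrite -/(octv u) => /(congr1 f) + /(congr1 f).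
  rewrite !aut_morph fe /fu; case: (f (octv u)) => [[[a u'] v'] b].
  rewrite (_ : (0, 0, 0, 0) = 0 :> oct F) // linear0.
  rewrite oct_e_mull oct_e_mulr => /(congr1 (fun z : oct F => (z.1.1.2, z.2))).
  by move=> /= [<- <-] /(congr1 (fun z : oct F => z.1.1.1)) /= ->.
have fuL : linear fu.
  move=> k u v; rewrite /fu (_ : octv _ = k *: octv u + octv v) ?linearP //.
  by rewrite octZD !mulr0 !scaler0 !addr0.
pose fl := GRing.isLinear.Build F 'rV[F]_3 'rV[F]_3 *:%R fu fuL.
pose f' : {linear 'rV[F]_3 -> 'rV[F]_3} := HB.pack fu fl.
by exists (lin1_mx f') => u; rewrite mul_rV_lin1 E.
Qed.

Lemma octE (a b : F) u v :
  (a, u, v, b) = (a - b) *: oct_e + (octu u + (octv v + b *: oct_one F)) :> oct F.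
Proof.
rewrite /octu /octv /oct_e /oct_one !octZ !octD.
octonion_ring.
Qed.

(** The products u * v' = u.v' and u * u' = u x u' make P and Q
    contragredient, and then force det P = 1. *)
Lemma stab_oct_e f : f oct_e = oct_e ->
  exists PQ : 'M[F]_3 * 'M[F]_3,
    [/\ \det PQ.1 = 1, PQ.1 *m PQ.2^T = 1%:M & f =1 block_fun PQ.1 PQ.2].
Proof.
move=> fe; have [P fP] := stab_e_u fe; have [Q fQ] := stab_e_v fe.
have duv u v : dot3 (u *m P) (v *m Q) = dot3 u v.
  have : f (oct_mul (octu u) (octv v)) = oct_mul (octu (u *m P)) (octv (v *m Q)).
    by rewrite aut_morph fP fQ.
  have E u1 v1 : oct_mul (octu u1) (octv v1) = dot3 u1 v1 *: oct_e.
    rewrite /= octZ; octonion_ring.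
  by rewrite !E linearZ /= fe /oct_e !octZ !mulr1 => -[].
have cuu u u' : cross3 (u *m P) (u' *m P) = cross3 u u' *m Q.
  have : f (oct_mul (octu u) (octu u')) = oct_mul (octu (u *m P)) (octu (u' *m P)).
    by rewrite aut_morph !fP.
  have E u1 u2 : oct_mul (octu u1) (octu u2) = octv (cross3 u1 u2).
    rewrite /=; octonion_ring.
  by rewrite !E fQ => -[].
have PQ : P *m Q^T = 1%:M.
  apply/contragredientC/row_matrixP => i; apply: dot3_inj => w.
  by rewrite !rowE mulmx1 mulmxA dot3C -dot3_mul duv dot3C.
exists (P, Q); split=> //=.
  rewrite det_cross3 !(rowE _ P) cuu dot3C duv dot3C.
  have := det_cross3 (1%:M : 'M[F]_3).
  by rewrite det1 !rowE !mulmx1 => <-.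
move=> [[[a u] v] b].
by rewrite [in LHS]octE !linearD !linearZ /= fP fQ fe aut_oct_one -octE.
Qed.

End Idempotents.

(** * Automorphisms of finite order fix an idempotent *)

Section Isotropic.
Variable F : numClosedFieldType.
Implicit Types (u v w : 'rV[F]_3) (x y z : oct F) (f g h : oct_aut F).

Lemma prim_root_exists m : (0 < m)%N -> exists z : F, m.-primitive_root z.
Proof.
move=> m0; have [r r_def] := closed_field_poly_normal ('X^m - 1 : {poly F}).
rewrite (monicP _) ?monicXnsubC // scale1r in r_def.
suff /hasP[z _ zP] : has m.-primitive_root r by exists z.
apply: has_prim_root => //.
- by apply/allP => z; rewrite -root_prod_XsubC -r_def.
- by rewrite -separable_prod_XsubC -r_def separable_Xn_sub_1 // pnatr_eq0 -lt0n.
- by rewrite -ltnS -(size_prod_XsubC r id) -r_def size_XnsubC.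
Qed.

(** The unnormalised projection onto the la^-1-eigenspace of f, when both f
    and la have order dividing m. *)
Definition twisted_avg m f (la : F) z := \sum_(k < m) la ^+ k *: iter k f z.

Lemma twisted_avgP m f la z : (f ^+ m)%g = 1%g -> la ^+ m = 1 ->
  la *: f (twisted_avg m f la z) = twisted_avg m f la z.
Proof.
move=> fm lm; rewrite linear_sum scaler_sumr /twisted_avg.
case: m fm lm => [|m] fm lm; first by rewrite !big_ord0.
rewrite big_ord_recr [RHS]big_ord_recl addrC /=; congr (_ + _); last first.
  rewrite linearZ scalerA -exprS lm scale1r expr0 scale1r.
  by have := aut_expE f m.+1 z; rewrite fm aut_1E => /esym.
by apply: eq_bigr => k _; rewrite linearZ scalerA -exprS.
Qed.

Lemma oct_mulZl (a : F) x y : oct_mul (a *: x) y = a *: oct_mul x y.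
Proof.
move: x y => [[[a1 u] v] b] [[[a' u'] v'] b']; rewrite octZ /= octZ.
octonion_ring.
Qed.

Lemma oct_mulZr (a : F) x y : oct_mul x (a *: y) = a *: oct_mul x y.
Proof.
move: x y => [[[a1 u] v] b] [[[a' u'] v'] b']; rewrite octZ /= octZ.
octonion_ring.
Qed.

Lemma oct_mulDr x y z : oct_mul x (y + z) = oct_mul x y + oct_mul x z.
Proof.
move: x y z => [[[a u] v] b] [[[a' u'] v'] b'] [[[c s] t] d].
rewrite octD /= octD.
octonion_ring.
Qed.

Lemma oct_trD x y : oct_tr (x + y) = oct_tr x + oct_tr y.
Proof. by move: x y => [[[a u] v] b] [[[a' u'] v'] b'] /=; ring. Qed.

Lemma oct_trZ (a : F) x : oct_tr (a *: x) = a * oct_tr x.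
Proof. by move: x => [[[a1 u] v] b]; rewrite octZ /=; ring. Qed.

Lemma oct_normZ (a : F) x : oct_norm (a *: x) = a ^+ 2 * oct_norm x.
Proof. by move: x => [[[a1 u] v] b]; rewrite octZ /= !row3E; ring. Qed.

Lemma oct_tr_nondegenerate x : (forall y, oct_tr (oct_mul x y) = 0) -> x = 0.
Proof.
move: x => [[[a u] v] b] t0; congr (_, _, _, _).
- by rewrite -(t0 (1, 0, 0, 0)) /= !row3E; ring.
- apply: dot3_inj => w; rewrite (_ : dot3 0 w = 0); last by rewrite !row3E; ring.
  by rewrite -(t0 (0, 0, w, 0)) /= !row3E; ring.
- apply: dot3_inj => w; rewrite (_ : dot3 0 w = 0); last by rewrite !row3E; ring.
  by rewrite -(t0 (0, w, 0, 0)) /= !row3E; ring.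
- by rewrite -(t0 (0, 0, 0, 1)) /= !row3E; ring.
Qed.

Lemma iter_oct_mul f n x y : iter n f (oct_mul x y) = oct_mul (iter n f x) (iter n f y).
Proof. by rewrite -!aut_expE aut_morph. Qed.

Lemma iter_oct_tr f n x : oct_tr (iter n f x) = oct_tr x.
Proof. by rewrite -!aut_expE aut_tr. Qed.

(** The trace form tr (x y) is nondegenerate and f-invariant, so averaging a
    vector that pairs with x gives y with f y = la^-1 y and tr (x y) <> 0.
    Then x y is fixed by f, has norm n x * n y = 0 and nonzero trace, and only
    needs rescaling. *)
Lemma fixed_idem_of_isotropic m f la x : (0 < m)%N -> (f ^+ m)%g = 1%g ->
  x != 0 -> oct_norm x = 0 -> f x = la *: x ->
  exists e, [/\ oct_tr e = 1, oct_norm e = 0 & f e = e].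
Proof.
move=> m0 fm x0 nx fx.
have fkx k : iter k f x = la ^+ k *: x.
  elim: k => [|k IH]; first by rewrite scale1r.
  by rewrite iterS IH linearZ /= fx scalerA exprSr.
have lm : la ^+ m = 1.
  have := fkx m; rewrite -aut_expE fm aut_1E => /eqP.
  rewrite -subr_eq0 -{1}[x]scale1r -scalerBl scaler_eq0 (negPf x0) orbF subr_eq0.
  by move/eqP.
have [z tz] : exists z, oct_tr (oct_mul x z) != 0.
  apply: contrapT => /forallNP e; move/eqP: x0; apply.
  by apply: oct_tr_nondegenerate => y; apply/eqP/negP => /negP; apply: e.
pose y := twisted_avg m f la z; have yE : la *: f y = y by apply: twisted_avgP.
have txy : oct_tr (oct_mul x y) = m%:R * oct_tr (oct_mul x z).
  rewrite (big_morph (fun y => oct_tr (oct_mul x y)) (id1 := 0) (op1 := +%R)).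
  - rewrite (eq_bigr (fun=> oct_tr (oct_mul x z))).
      by rewrite sumr_const card_ord mulr_natl.
    move=> k _; rewrite oct_mulZr -oct_mulZl -fkx -iter_oct_mul; exact: iter_oct_tr.
  - by move=> y1 y2; rewrite oct_mulDr oct_trD.
  - by rewrite -(scale0r x) oct_mulZr oct_trZ mul0r.
have t0 : oct_tr (oct_mul x y) != 0 by rewrite txy mulf_neq0 // pnatr_eq0 -lt0n.
exists ((oct_tr (oct_mul x y))^-1 *: oct_mul x y); split.
- by rewrite oct_trZ mulVf.
- by rewrite oct_normZ oct_normM nx mul0r mulr0.
- rewrite linearZ; congr (_ *: _).
  by rewrite [LHS]aut_morph fx oct_mulZl -oct_mulZr yE.
Qed.

(** A binary quadratic form over an algebraically closed field has a
    nontrivial zero. *)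
Lemma isotropic_combination x y :
  exists s t : F, (s, t) != (0, 0) /\ oct_norm (s *: x + t *: y) = 0.
Proof.
have [y0|y0] := eqVneq (oct_norm y) 0.
  by exists 0, 1; rewrite scale0r add0r scale1r xpair_eqE oner_eq0 andbF.
pose B := oct_norm (x + y) - oct_norm x - oct_norm y.
pose r := sqrtC (B ^+ 2 - 4 * oct_norm x * oct_norm y).
have r2 : r * r = B ^+ 2 - 4 * oct_norm x * oct_norm y by rewrite -expr2 sqrtCK.
exists 1, ((r - B) / (2 * oct_norm y)); split; first by rewrite xpair_eqE oner_eq0.
have -> (t : F) : oct_norm (1 *: x + t *: y) = oct_norm x + t * B + t ^+ 2 * oct_norm y.
  rewrite /B; move: x y {B r r2 y0} => [[[a u] v] b] [[[a' u'] v'] b'].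
  by rewrite !octZ octD /= !row3E; ring.
set n := oct_norm x; set C := oct_norm y.
have -> : n + (r - B) / (2 * C) * B + ((r - B) / (2 * C)) ^+ 2 * C =
    (r * r - (B ^+ 2 - 4 * n * C)) / (4 * C) by field.
by rewrite r2 subrr mul0r.
Qed.

Lemma aut_norm_eigen f la x : f x = la *: x -> la ^+ 2 != 1 -> oct_norm x = 0.
Proof.
move=> fx l1; have := aut_norm f x.
rewrite fx oct_normZ => /eqP; rewrite -subr_eq0 -{2}[oct_norm x]mul1r -mulrBl.
by rewrite mulf_eq0 subr_eq0 (negPf l1) => /eqP.
Qed.

(** In the totally isotropic plane spanned by i and j, some nonzero x has
    x + f x isotropic.  Either x + f x is an eigenvector, or it vanishes and x
    itself is one. *)
Lemma isotropic_eigenvector_invol f : (forall x, f (f x) = x) ->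
  exists x la, [/\ x != 0, oct_norm x = 0 & f x = la *: x].
Proof.
move=> f2; pose i : oct F := octu (delta_mx 0 0); pose j : oct F := octu (delta_mx 0 1).
have [s [t [st0 n0]]] := isotropic_combination (i + f i) (j + f j).
pose x := s *: i + t *: j.
have xfx : x + f x = s *: (i + f i) + t *: (j + f j).
  by rewrite linearD !linearZ /= !scalerDr addrACA.
have [x0|x0] := eqVneq (x + f x) 0; last first.
  exists (x + f x), 1; split=> //; first by rewrite xfx.
  have -> : f (x + f x) = f x + f (f x) by exact: linearD.
  by rewrite f2 scale1r addrC.
exists x, (-1); split.
- apply: contra st0 => /eqP.
  rewrite /x /i /j /octu !octZ octD => /(congr1 (fun z : oct F => z.1.1.2)) /= /rowP z.
  have := z 0; have := z 1; rewrite !mxE /= !mulr1 !mulr0 addr0 add0r => -> ->.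
  by rewrite eqxx.
- by rewrite /x /i /j /octu !octZ octD /= !row3E; ring.
- by apply/eqP; rewrite scaleN1r -addr_eq0 addrC x0.
Qed.

(** Orthogonality of the characters of the cyclic group of order m. *)
Lemma sum_twisted_avg m f (z : F) x : m.-primitive_root z ->
  \sum_(j < m) twisted_avg m f (z ^+ j) x = m%:R *: x.
Proof.
move=> zP; have m0 := prim_order_gt0 zP; rewrite exchange_big /=.
case: m zP m0 => // m zP _; rewrite big_ord_recl [X in _ + X]big1 ?addr0 => [|k _].
  rewrite (eq_bigr (fun=> x)) => [|j _]; last by rewrite expr0 scale1r.
  by rewrite sumr_const card_ord scaler_nat.
rewrite -scaler_suml (_ : \sum_(i < m.+1) _ = 0) ?scale0r //.
have zk1 : z ^+ (lift ord0 k) != 1 by rewrite -(prim_order_dvd zP) gtnNdvd //= ltnS.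
apply: (mulfI (x := z ^+ (lift ord0 k) - 1)); rewrite ?subr_eq0 //.
rewrite mulr0 (eq_bigr (fun j : 'I_m.+1 => (z ^+ (lift ord0 k)) ^+ j)) => [|j _].
  by rewrite -subrX1 exprAC (prim_expr_order zP) expr1n subrr.
by rewrite exprAC.
Qed.

(** An eigenvector with eigenvalue la, la^2 <> 1, is automatically isotropic as
    f preserves the norm.  When there is none, f^2 = 1, since the
    projections onto the eigenspaces of 1 and -1 add up to the identity. *)
Lemma isotropic_eigenvector m f : (0 < m)%N -> (f ^+ m)%g = 1%g ->
  exists x la, [/\ x != 0, oct_norm x = 0 & f x = la *: x].
Proof.
move=> m0 fm; have [z zP] := prim_root_exists m0.
have [f2|] := pselect (forall x, f (f x) = x); first exact: isotropic_eigenvector_invol.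
move=> /existsNP[x fx]; apply: contrapT => none; apply: fx.
pose P j := twisted_avg m f (z ^+ j) x.
have fP j : f (P j) = (z ^+ j)^-1 *: P j.
  rewrite /P -[in RHS](twisted_avgP _ fm) ?scalerA.
    rewrite mulVf ?scale1r // expf_neq0 //.
    apply/eqP => z0; have /eqP := prim_expr_order zP.
    by rewrite z0 expr0n gtn_eqF // eq_sym oner_eq0.
  by rewrite exprAC (prim_expr_order zP) expr1n.
have ffP j : f (f (P j)) = P j.
  rewrite fP linearZ /= fP scalerA -expr2.
  have [->|l1] := eqVneq ((z ^+ j)^-1 ^+ 2) 1; first by rewrite scale1r.
  have [->|P0] := eqVneq (P j) 0; first by rewrite scaler0.
  case: none; exists (P j), ((z ^+ j)^-1); split=> //.
  exact: aut_norm_eigen (fP j) l1.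
apply: (scalerI (a := m%:R)); first by rewrite pnatr_eq0 -lt0n.
rewrite -!linearZ /= -(sum_twisted_avg f x zP) !linear_sum.
by apply: eq_bigr => j _; exact: ffP.
Qed.

Lemma similar_stab_e m f : (0 < m)%N -> (f ^+ m)%g = 1%g ->
  exists g, similar f g /\ g (oct_e F) = oct_e F.
Proof.
move=> m0 fm; have [x [la [x0 nx fx]]] := isotropic_eigenvector m0 fm.
have [e [te ne fe]] := fixed_idem_of_isotropic m0 fm x0 nx fx.
have [h he] := oct_e_transitive te ne.
exists (h * f * h^-1)%g; split; last by rewrite !aut_mulE -he aut_K fe.
by exists h => y; rewrite !aut_mulE aut_K.
Qed.

End Isotropic.

(** * Conjugation into the diagonal torus *)

Section Torus.
Variable F : numClosedFieldType.
Implicit Types (d : 'rV[F]_3) (P Q S T : 'M[F]_3) (f g : oct_aut F).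

(** Conjugacy of the blocks P under GL3 suffices: dividing S by a cube root of
    its determinant puts it in SL3, and the relation between the blocks Q
    follows by taking contragredients. *)
Lemma similar_block f1 f2 P1 Q1 P2 Q2 S :
  f1 =1 block_fun P1 Q1 -> f2 =1 block_fun P2 Q2 ->
  P1 *m Q1^T = 1%:M -> P2 *m Q2^T = 1%:M ->
  S \in unitmx -> P1 *m S = S *m P2 -> similar f1 f2.
Proof.
move=> f1E f2E PQ1 PQ2 Su PS.
have dS : \det S != 0 by rewrite -unitfE.
pose c := 3.-root (\det S)^-1.
have c3 : c ^+ 3 = (\det S)^-1 by rewrite rootCK.
pose S' := c *: S; pose T := (invmx S')^T.
have dS' : \det S' = 1 by rewrite /S' detZ c3 mulVf.
have ST : S' *m T^T = 1%:M by rewrite trmxK mulmxV // unitmxE dS' unitr1.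
have PS' : P1 *m S' = S' *m P2 by rewrite -scalemxAr PS scalemxAl.
have QT : Q1 *m T = T *m Q2.
  apply: trmx_inj; rewrite !trmx_mul.
  have TP : T^T *m P1 = P2 *m T^T.
    by rewrite -[LHS]mulmx1 -ST mulmxA -(mulmxA _ P1) PS' !mulmxA (mulmx1C ST) mul1mx.
  by rewrite -[RHS]mulmx1 -PQ1 mulmxA -(mulmxA _ _ P1) TP !mulmxA (mulmx1C PQ2) mul1mx.
have [h hE] := aut_block dS' ST.
exists h => -[[[a u] v] b]; rewrite f1E hE hE f2E /=.
by rewrite -!mulmxA PS' QT.
Qed.

Lemma diagonalizable_finite_order m P : (0 < m)%N -> P ^+ m = 1 ->
  exists2 R, R \in unitmx & exists d, R *m P = diag_mx d *m R.
Proof.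
move=> m0 Pm; have [z zP] := prim_root_exists F m0.
suff [R Ru /diagonalizable_forPex[d /(simmxP Ru) e]] : diagonalizable P.
  by exists R => //; exists d.
apply/diagonalizableP; exists [seq z ^+ i | i <- iota 0 m].
  rewrite map_inj_in_uniq ?iota_uniq // => i j.
  rewrite !mem_iota !add0n => /= i_m j_m /eqP.
  by rewrite (eq_prim_root_expr zP) !modn_small // => /eqP.
rewrite big_map (_ : iota 0 m = index_iota 0 m) ?(factor_Xn_sub_1 zP); last first.
  by rewrite /index_iota subn0.
by apply: mxminpoly_min; rewrite rmorphB rmorphXn rmorph1 /= horner_mx_X Pm subrr.
Qed.

Lemma diag_mx_finite_order m P R d : P ^+ m = 1 -> R \in unitmx ->
  R *m P = diag_mx d *m R -> forall i, d 0 i ^+ m = 1.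
Proof.
move=> Pm Ru RP i; pose r := row i R.
have rP k : r *m P ^+ k = d 0 i ^+ k *: r.
  elim: k => [|k IH]; first by rewrite mulmx1 scale1r.
  rewrite exprSr [_ * _]/(_ *m _) mulmxA IH -scalemxAl /r -row_mul RP.
  by rewrite row_mul row_diag_mx -scalemxAl -rowE scalerA exprSr.
have r0 : r != 0.
  apply/eqP => r0; have : row i (R *m invmx R) = 0 by rewrite row_mul -/r r0 mul0mx.
  rewrite mulmxV // => /rowP/(_ i)/eqP.
  by rewrite !mxE eqxx oner_eq0.
apply/eqP; rewrite -subr_eq0; move/eqP: (rP m); rewrite Pm mulmx1 -subr_eq0.
rewrite -{1}[r]scale1r -scalerBl scaler_eq0 (negPf r0) orbF.
by rewrite -oppr_eq0 opprB.
Qed.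

Definition row3 (a b c : F) : 'rV[F]_3 := \row_i nth 0 [:: a; b; c] i.

Definition torus_fun (a b c : F) : oct F -> oct F :=
  block_fun (diag_mx (row3 a b c)) (diag_mx (row3 a^-1 b^-1 c^-1)).

Lemma diag_row3_contragredient (a b c : F) : a * b * c = 1 ->
  \det (diag_mx (row3 a b c)) = 1 /\
  diag_mx (row3 a b c) *m (diag_mx (row3 a^-1 b^-1 c^-1))^T = 1%:M.
Proof.
move=> abc; split.
  by rewrite det_diag !big_ord_recl big_ord0 !mxE /= mulr1 mulrA.
have := oner_neq0 F; rewrite -abc !mulf_eq0 !negb_or -andbA => /and3P[a0 b0 c0].
rewrite tr_diag_mx mulmx_diag; apply/matrixP => i j; rewrite !mxE.
case: eqP => //= _; move: i; apply: ord3P => /=; by rewrite mulfV.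
Qed.

Lemma torus_fun1 : torus_fun (1 : F) 1 1 =1 id.
Proof.
move=> [[[a u] v] b]; rewrite /torus_fun /= !invr1.
have -> : row3 1 1 1 = const_mx 1 :> 'rV[F]_3 by apply: row3P; rewrite !mxE.
by rewrite diag_const_mx !mulmx1.
Qed.

Lemma torus_funM (a b c a' b' c' : F) x :
  torus_fun a b c (torus_fun a' b' c' x) = torus_fun (a * a') (b * b') (c * c') x.
Proof.
have row3M (s t r s' t' r' : F) : diag_mx (row3 s' t' r') *m diag_mx (row3 s t r) =
    diag_mx (row3 (s * s') (t * t') (r * r')).
  by rewrite mulmx_diag; congr diag_mx; apply: row3P; rewrite !mxE /= mulrC.
case: x => [[[x u] v] y]; rewrite /torus_fun /= -!mulmxA !row3M.
by rewrite -!invfM.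
Qed.

(** [xget] picks the automorphism given by [torus_fun]; it exists when
    a * b * c = 1, and the value has no meaning otherwise. *)
Definition torus (a b c : F) : oct_aut F :=
  xget 1%g [set g : oct_aut F | g =1 torus_fun a b c]%classic.

Lemma torusE a b c : a * b * c = 1 -> torus a b c =1 torus_fun a b c.
Proof.
move=> /diag_row3_contragredient[dP PQ]; rewrite /torus.
have [g gE] := aut_block dP PQ.
by case: xgetP => [h _ //|/(_ g)]; case.
Qed.

(** Up to conjugacy f fixes e, so it is given by a matrix P in SL3 of finite
    order; P is diagonalizable because 'X^m - 1 has simple roots. *)
Lemma similar_torus m f : (0 < m)%N -> (f ^+ m)%g = 1%g ->
  exists a b c : F, [/\ a ^+ m = 1, b ^+ m = 1, c ^+ m = 1, a * b * c = 1 &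
    similar f (torus a b c)].
Proof.
move=> m0 fm; have [g [[h fg] ge]] := similar_stab_e m0 fm.
have [[P Q] /= [dP PQ gE]] := stab_oct_e ge.
have gm : (g ^+ m)%g = 1%g.
  apply: aut_ext => x; rewrite aut_1E aut_expE -[x](aut_VK h).
  have hk k y : iter k g (h y) = h (iter k f y).
    by elim: k => //= k ->; rewrite fg.
  by rewrite hk -aut_expE fm aut_1E.
have Pm : P ^+ m = 1.
  apply/row_matrixP => i; rewrite !rowE.
  have gk k u : iter k g (octu u) = octu (u *m P ^+ k).
    elim: k => [|k IH]; first by rewrite mulmx1.
    by rewrite iterS IH gE /= !mul0mx exprSr mulmxA.
  have := gk m (delta_mx 0 i); rewrite -aut_expE gm aut_1E => -[<-].
  by rewrite mulmx1.
have [R Ru [d RP]] := diagonalizable_finite_order m0 Pm.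
have dm := diag_mx_finite_order Pm Ru RP.
have dE : d = row3 (d 0 0) (d 0 1) (d 0 2%:R) by apply: row3P; rewrite !mxE.
have d1 : d 0 0 * d 0 1 * d 0 2%:R = 1.
  have := congr1 determinant RP; rewrite !det_mulmx dP mulr1 dE det_diag.
  rewrite !big_ord_recl big_ord0 !mxE /= mulr1 mulrA -{1}[\det R]mul1r.
  by move/mulIf => <- //; rewrite -unitfE.
exists (d 0 0), (d 0 1), (d 0 2%:R); split=> //.
apply: similar_trans (ex_intro _ h fg) _.
have [_ PQ2] := diag_row3_contragredient d1.
apply: (similar_block (S := invmx R) gE (torusE d1) PQ PQ2); first by rewrite unitmx_inv.
by rewrite -dE -[LHS](mulKmx Ru) (mulmxA R P) RP mulmxK.
Qed.

End Torus.

(** * The Weyl group action on the torus *)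

Section TorusSymmetries.
Variable F : numClosedFieldType.

Lemma similar_torus_perm (s : 'S_3) (a b c a' b' c' : F) :
  a * b * c = 1 -> a' * b' * c' = 1 ->
  (forall i, row3 a b c 0 i = row3 a' b' c' 0 (s i)) ->
  similar (torus a b c) (torus a' b' c').
Proof.
move=> abc abc' e.
have [_ PQ] := diag_row3_contragredient abc.
have [_ PQ'] := diag_row3_contragredient abc'.
apply: (similar_block (S := perm_mx s) (torusE abc) (torusE abc') PQ PQ').
  exact: unitmx_perm.
apply/matrixP => i j; rewrite mul_diag_mx mul_mx_diag [LHS]mxE [RHS]mxE e.
have -> : perm_mx s i j = (s i == j)%:R :> F by rewrite !mxE.
by case: eqP => [->|_]; rewrite ?mulr0 ?mul0r // mulr1 mul1r.
Qed.

Lemma similar_torus_swap12 (a b c : F) : a * b * c = 1 ->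
  similar (torus a b c) (torus b a c).
Proof.
move=> abc; apply: (similar_torus_perm (s := tperm 0 1)) => //.
  by rewrite (mulrC b).
by apply: ord3P; rewrite ?tpermL ?tpermR ?tpermD // !mxE.
Qed.

Lemma similar_torus_swap23 (a b c : F) : a * b * c = 1 ->
  similar (torus a b c) (torus a c b).
Proof.
move=> abc; apply: (similar_torus_perm (s := tperm 1 2%:R)) => //.
  by rewrite mulrAC.
by apply: ord3P; rewrite ?tpermL ?tpermR ?tpermD // !mxE.
Qed.

Lemma similar_torus_inv (a b c : F) : a * b * c = 1 ->
  similar (torus a b c) (torus a^-1 b^-1 c^-1).
Proof.
move=> abc.
have abc' : a^-1 * b^-1 * c^-1 = 1 by rewrite -!invfM abc invr1.
have [h hE] : exists h : oct_aut F, h =1 @swap_fun F.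
  apply: oct_aut_of; first exact: swap_fun_linear; first exact: swap_funM.
  exact: can_inj (@swap_funK F).
exists h => -[[[x u] v] y]; rewrite torusE // hE hE torusE //= /torus_fun /= !invrK.
by rewrite !mulNmx.
Qed.

End TorusSymmetries.

(** * Eigenvalues separate the conjugacy classes of the torus *)

(** In particular the list of eigenvalues on an eigenbasis is, up to order,
    an invariant of f. *)
Lemma dim_eigenspace_basis (F : fieldType) (V : vectType F) n (X : n.-tuple V)
    (d : n.-tuple F) (f : 'End(V)) (la : F) :
  basis_of fullv X -> (forall i, f (tnth X i) = tnth d i *: tnth X i) ->
  \dim (lker (f - la *: \1%VF)) = count_mem la d.
Proof.
move=> bX fX; have frX := basis_free bX.
pose p x := f x == la *: x.
have pE i : p (tnth X i) = (tnth d i == la).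
  rewrite /p fX -subr_eq0 -scalerBl scaler_eq0 subr_eq0.
  by rewrite (negPf (free_not0 frX (mem_tnth i X))) orbF.
have kerE x : (x \in lker (f - la *: \1%VF)) = p x.
  by rewrite memv_ker !lfunE /= opp_lfunE scale_lfunE id_lfunE subr_eq0.
have -> : lker (f - la *: \1%VF) = <<filter p X>>%VS.
  apply/eqP; rewrite eqEsubv; apply/andP; split; last first.
    by apply/span_subvP => x; rewrite mem_filter kerE => /andP[].
  apply/subvP => x; rewrite kerE /p => /eqP fx.
  have xE := coord_basis bX (memvf x).
  have c0 i : coord X i x * (tnth d i - la) = 0.
    pose k i := coord X i x * (tnth d i - la).
    have /freeP/(_ k) k0 := frX; apply: k0 i.
    transitivity (f x - la *: x); last by rewrite fx subrr.
    rewrite [in RHS]xE linear_sum scaler_sumr -sumrB; apply: eq_bigr => i _.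
    by rewrite -tnth_nth linearZ /= fX !scalerA -scalerBl /k mulrBr [la * _]mulrC.
  rewrite xE; apply: memv_suml => i _.
  have := c0 i => /eqP; rewrite mulf_eq0 subr_eq0 -pE => /orP[/eqP->|pi].
    by rewrite scale0r mem0v.
  by rewrite memvZ // memv_span // mem_filter -tnth_nth mem_tnth andbT.
transitivity (size (filter p X)); first exact/eqP/filter_free.
rewrite size_filter -!sum1_count !big_tuple.
by apply: eq_bigl => i; rewrite pE.
Qed.

Section TorusEigenvalues.
Variable F : numClosedFieldType.

Definition torus_eigenvalues (a b c : F) : 8.-tuple F :=
  [tuple 1; 1; a; b; c; a^-1; b^-1; c^-1].

Definition torus_eigenbasis : 8.-tuple (oct F) :=
  [tuple (1, 0, 0, 0) : oct F; (0, 0, 0, 1) : oct F;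
    octu (delta_mx 0 0); octu (delta_mx 0 1); octu (delta_mx 0 2%:R);
    octv (delta_mx 0 0); octv (delta_mx 0 1); octv (delta_mx 0 2%:R)].

Lemma torus_eigenbasisP : basis_of fullv torus_eigenbasis.
Proof.
rewrite basisEdim dimvf /= andbT; apply/subvP => -[[[a u] v] b] _.
have -> : (a, u, v, b) = a *: tnth torus_eigenbasis 0 + b *: tnth torus_eigenbasis 1 +
  (u 0 0 *: tnth torus_eigenbasis 2%:R + u 0 1 *: tnth torus_eigenbasis 3%:R +
   u 0 2%:R *: tnth torus_eigenbasis 4%:R) +
  (v 0 0 *: tnth torus_eigenbasis 5%:R + v 0 1 *: tnth torus_eigenbasis 6%:R +
   v 0 2%:R *: tnth torus_eigenbasis 7%:R).
  rewrite !(tnth_nth 0) /= /octu /octv !octZ !octD.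
  by congr (_, _, _, _); rewrite /=; by [ring|apply: row3P; rewrite !mxE /=; ring].
by rewrite !(memvD, memvZ) // memv_span // mem_tnth.
Qed.

Lemma torus_eigen (a b c : F) (i : 'I_8) : a * b * c = 1 ->
  torus a b c (tnth torus_eigenbasis i) =
  tnth (torus_eigenvalues a b c) i *: tnth torus_eigenbasis i.
Proof.
move=> abc; rewrite torusE // /torus_fun !(tnth_nth 0).
case: i => -[|[|[|[|[|[|[|[|//]]]]]]]] i8 /=; rewrite /octu /octv octZ;
  congr (_, _, _, _); by [ring|apply: row3P; rewrite mul_mx_diag !mxE /=; ring].
Qed.

(** A conjugating automorphism h carries the standard eigenbasis of the first
    element to an eigenbasis of the second, so the second has two
    eigenbases, with the two lists of eigenvalues. *)
Lemma similar_torus_eigenvalues (a b c a' b' c' : F) :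
  a * b * c = 1 -> a' * b' * c' = 1 -> similar (torus a b c) (torus a' b' c') ->
  perm_eq (torus_eigenvalues a b c) (torus_eigenvalues a' b' c').
Proof.
move=> abc abc' [h hE]; apply/allP => la _; apply/eqP.
pose X := map_tuple h torus_eigenbasis.
have bX : basis_of fullv X.
  have /andP[h0 _] := valP h.
  rewrite -(lker0_limgf h0); apply: limg_basis_of torus_eigenbasisP.
  by rewrite (eqP h0) capv0.
have fX i : torus a' b' c' (tnth X i) = tnth (torus_eigenvalues a b c) i *: tnth X i.
  by rewrite tnth_map -hE torus_eigen // linearZ.
rewrite -(dim_eigenspace_basis la bX fX).
apply: dim_eigenspace_basis torus_eigenbasisP _ => i.
by rewrite torus_eigen.
Qed.

End TorusEigenvalues.

(** * Partitions into at most three parts *)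

(** A partition a >= b >= c >= 0 of m is recorded by (b, c), as a = m - b - c. *)
Definition partitions3 m : seq (nat * nat) :=
  [seq (b, c) | c <- iota 0 (m %/ 3).+1, b <- iota c ((m - c) %/ 2 - c).+1].

Lemma mem_partitions3 m b c :
  ((b, c) \in partitions3 m) = (c <= b)%N && (2 * b + c <= m)%N.
Proof.
apply/allpairsPdep/andP => [[c' [b' []]]|[cb bcm]].
  rewrite !mem_iota => cm bm [-> ->]; split; lia.
by exists c, b; rewrite !mem_iota; split=> //; lia.
Qed.

Lemma uniq_partitions3 m : uniq (partitions3 m).
Proof.
apply: allpairs_uniq_dep => [|c _|]; rewrite ?iota_uniq //.
by move=> [c b] [c' b'] _ _ [-> ->].
Qed.

Lemma size_partitions3 m :
  size (partitions3 m) = (\sum_(0 <= c < (m %/ 3).+1) ((m - c) %/ 2 - c).+1)%N.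
Proof.
rewrite size_allpairs_dep sumnE big_map /index_iota subn0.
by apply: eq_bigr => c _; rewrite size_iota.
Qed.

(** The partitions of m + 3 with three nonzero parts are those of m with 1
    added to each part; the other term counts those with c = 0. *)
Lemma size_partitions3_add3 m :
  size (partitions3 (m + 3)) = (size (partitions3 m) + ((m + 3) %/ 2).+1)%N.
Proof.
rewrite !size_partitions3 (_ : (m + 3) %/ 3 = (m %/ 3).+1)%N; last lia.
rewrite [LHS]big_nat_recl // !subn0 addnC.
congr (_ + _)%N; apply: eq_big_nat => c /andP[_ cm]; lia.
Qed.

(** Two steps of the recurrence add m + 6, the increment of
    (m ^ 2 + 6 * m) / 12 from m to m + 6. *)
Lemma size_partitions3E m : (12 * size (partitions3 m) = m ^ 2 + 6 * m +
  nth 0 [:: 12; 5; 8; 9; 8; 5] (m %% 6))%N.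
Proof.
rewrite [in RHS](divn_eq m 6) [in LHS](divn_eq m 6) modnMDl modn_mod.
elim: (m %/ 6)%N => [|q IH].
  rewrite mul0n add0n; have := ltn_pmod m (isT : 0 < 6)%N.
  by case: (m %% 6)%N => [|[|[|[|[|[|//]]]]]] _; rewrite size_partitions3 unlock.
rewrite (_ : q.+1 * 6 + m %% 6 = q * 6 + m %% 6 + 3 + 3)%N; last lia.
rewrite !size_partitions3_add3; move: IH; move: (nth _ _ _) (size _) => k s; nia.
Qed.

(** * Classes of elements of order dividing m *)

Section Counting.
Variables (F : numClosedFieldType) (m : nat) (z : F).
Hypothesis zP : m.-primitive_root z.

Let m_gt0 : (0 < m)%N := prim_order_gt0 zP.

Lemma prim_root_neq0 : z != 0.
Proof.
apply/eqP => z0; have /eqP := prim_expr_order zP.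
by rewrite z0 expr0n gtn_eqF // eq_sym oner_eq0.
Qed.

Lemma prim_exprB k : (k <= m)%N -> z ^+ (m - k) = (z ^+ k)^-1.
Proof.
move=> km; apply: (mulIf (expf_neq0 k prim_root_neq0)).
by rewrite -exprD subnK // mulVf ?expf_neq0 ?prim_root_neq0 ?(prim_expr_order zP).
Qed.

Definition torus_exp (a b c : nat) := torus (z ^+ a) (z ^+ b) (z ^+ c).

Lemma torus_exp1 a b c : (m %| a + b + c)%N -> z ^+ a * z ^+ b * z ^+ c = 1.
Proof. by rewrite -!exprD (prim_order_dvd zP) => /eqP. Qed.

Lemma similar_torus_exp_sorted a b c : (a + b + c = m)%N ->
  exists2 bc, bc \in partitions3 m &
    similar (torus_exp a b c) (torus_exp (m - bc.1 - bc.2) bc.1 bc.2).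
Proof.
pose good a b c := (a + b + c = m)%N -> exists2 bc, bc \in partitions3 m &
    similar (torus_exp a b c) (torus_exp (m - bc.1 - bc.2) bc.1 bc.2).
have swap12 x y w : good y x w -> good x y w.
  move=> gd e; have [|bc bcP s] := gd; first by rewrite (addnC y).
  exists bc => //; apply: similar_trans s; apply: similar_torus_swap12.
  by apply: torus_exp1; rewrite e.
have swap23 x y w : good x w y -> good x y w.
  move=> gd e; have [|bc bcP s] := gd; first by rewrite addnAC.
  exists bc => //; apply: similar_trans s; apply: similar_torus_swap23.
  by apply: torus_exp1; rewrite e.
have sorted x y w : (w <= y)%N -> (y <= x)%N -> good x y w.
  move=> wy yx e; exists (y, w); first by rewrite mem_partitions3; apply/andP; lia.
  rewrite /= (_ : m - y - w = x)%N; [exact: similar_refl|lia].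
rewrite -/(good a b c).
case: (leqP a b) => ab; case: (leqP b c) => bc; case: (leqP a c) => ac;
  try (exfalso; lia).
- by apply/swap12/swap23/swap12/sorted; lia.
- by apply/swap12/swap23/sorted; lia.
- by apply/swap12/sorted; lia.
- by apply/swap23/swap12/sorted; lia.
- by apply/swap23/sorted; lia.
- by apply/sorted; lia.
Qed.

(** The exponents can be taken in [0, m), and then add up to 0, m or 2 m.  The
    first case is the partition (m, 0, 0); the last reduces to the
    middle one by inversion. *)
Lemma similar_torus_exp (f : oct_aut F) : (f ^+ m)%g = 1%g ->
  exists2 bc, bc \in partitions3 m &
    similar f (torus_exp (m - bc.1 - bc.2) bc.1 bc.2).
Proof.
move=> fm; have [x [y [w [xm ym wm xyw sf]]]] := similar_torus m_gt0 fm.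
have [[a am] /= xE] := prim_rootP zP xm; have [[b bm] /= yE] := prim_rootP zP ym.
have [[c cm] /= wE] := prim_rootP zP wm; rewrite {}xE {}yE {}wE in xyw sf.
have : (m %| a + b + c)%N by rewrite (prim_order_dvd zP) !exprD xyw.
move=> /dvdnP[k abc].
have : [\/ k = 0, k = 1 | k = 2]%N.
  by case: k abc => [|[|[|k]]] => e;
    [constructor 1|constructor 2|constructor 3|exfalso; nia].
case=> k_; rewrite {}k_ in abc.
- exists (0, 0)%N; first by rewrite mem_partitions3.
  have -> : torus_exp (m - 0 - 0) 0 0 = torus (z ^+ a) (z ^+ b) (z ^+ c).
    have [-> -> ->] : [/\ a = 0, b = 0 & c = 0]%N by split; lia.
    by rewrite /torus_exp !subn0 (prim_expr_order zP).
  exact: sf.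
- rewrite mul1n in abc; have [bc bcP s] := similar_torus_exp_sorted abc.
  by exists bc => //; apply: similar_trans s.
- have abc' : ((m - a) + (m - b) + (m - c) = m)%N by lia.
  have [bc bcP s] := similar_torus_exp_sorted abc'.
  exists bc => //; apply: similar_trans s; apply: similar_trans sf _.
  rewrite /torus_exp (prim_exprB (ltnW am)).
  rewrite (prim_exprB (ltnW bm)) (prim_exprB (ltnW cm)).
  by apply: similar_torus_inv.
Qed.

(** Sends z ^+ r and its inverse to the distance from r to the nearest
    multiple of m. *)
Definition fold_exp (la : F) :=
  find (fun k => (z ^+ k == la) || (z ^+ k == la^-1)) (iota 0 m).

Lemma fold_expV la : fold_exp la^-1 = fold_exp la.
Proof. by apply: eq_find => k; rewrite invrK orbC. Qed.

Lemma fold_expE r : (2 * r <= m)%N -> fold_exp (z ^+ r) = r.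
Proof.
move=> rm; have r_lt : (r < m)%N by move: m_gt0; lia.
have z0 := prim_root_neq0.
rewrite /fold_exp; set p := fun k => _.
have pr : p r by rewrite /p eqxx.
have hp : has p (iota 0 m) by apply/hasP; exists r; rewrite // mem_iota.
apply/eqP; rewrite eqn_leq; apply/andP; split.
  rewrite leqNgt; apply/negP => /(before_find 0).
  by rewrite nth_iota // add0n pr.
rewrite leqNgt; apply/negP => lt.
have := nth_find 0 hp; rewrite nth_iota ?add0n; last exact: leq_trans lt (ltnW r_lt).
move: (find p _) lt => k kr; rewrite /p => /orP[].
  rewrite (eq_prim_root_expr zP) !modn_small //; first by move/eqP; lia.
  exact: ltn_trans kr r_lt.
rewrite -(inj_eq (mulIf (expf_neq0 r z0))) mulVf ?expf_neq0 // -exprD.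
by rewrite -(prim_order_dvd zP) gtnNdvd //; lia.
Qed.

(** For a partition a >= b >= c of m, b and c are at most m / 2, so folding
    exponents leaves them alone, while a folds to a or to b + c, in either case
    at least b.  So folding the eigenvalues and sorting them gives the list
    0, 0, c, c, b, b, t, t, from which b and c can be read off. *)
Lemma partitions3_inj : {in partitions3 m &, forall bc bc',
  similar (torus_exp (m - bc.1 - bc.2) bc.1 bc.2)
          (torus_exp (m - bc'.1 - bc'.2) bc'.1 bc'.2) -> bc = bc'}.
Proof.
move=> [b c] [b' c']; rewrite !mem_partitions3 /= => /andP[cb bm] /andP[cb' bm'] s.
have dv x y : (2 * x + y <= m)%N -> (m %| m - x - y + x + y)%N.
  by move=> xy; rewrite (_ : m - x - y + x + y = m)%N //; lia.
have := perm_map fold_exp (similar_torus_eigenvalues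
  (torus_exp1 (dv _ _ bm)) (torus_exp1 (dv _ _ bm')) s).
rewrite /= !fold_expV.
have fold1 : fold_exp 1 = 0%N by rewrite -[1](expr0 z) fold_expE.
have top x y : (y <= x)%N -> (2 * x + y <= m)%N ->
  exists2 t, (x <= t)%N & fold_exp (z ^+ (m - x - y)) = t.
  move=> yx xym; case: (leqP (2 * (m - x - y)) m) => le.
    by exists (m - x - y)%N; [lia|rewrite fold_expE].
  exists (x + y)%N; [lia|rewrite -fold_expV -subnDA].
  by rewrite prim_exprB ?invrK ?fold_expE //; lia.
have [t bt ->] := top _ _ cb bm; have [t' bt' ->] := top _ _ cb' bm'.
rewrite fold1 !fold_expE; try lia.
move=> pe.
have E x y w : perm_eq [:: 0; 0; w; x; y; w; x; y]%N [:: 0; 0; y; y; x; x; w; w]%N.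
  by apply/seq.permP => p /=; lia.
have : [:: 0; 0; c; c; b; b; t; t]%N = [:: 0; 0; c'; c'; b'; b'; t'; t']%N.
  apply: (sorted_eq leq_trans anti_leq); rewrite /= ?leqnn ?cb ?bt ?cb' ?bt' //.
  by rewrite -(permPl (E _ _ _)) (permPl pe) E.
by case=> -> _ ->.
Qed.

Lemma torus_exp_order a b c : (m %| a + b + c)%N -> (torus_exp a b c ^+ m)%g = 1%g.
Proof.
move=> /torus_exp1 abc; apply: aut_ext => x; rewrite aut_expE aut_1E /torus_exp.
have it n y : iter n (torus (z ^+ a) (z ^+ b) (z ^+ c)) y =
    torus_fun (z ^+ a ^+ n) (z ^+ b ^+ n) (z ^+ c ^+ n) y.
  elim: n => [|n IH].
    by rewrite !expr0 torus_fun1.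
  rewrite iterS IH torusE // torus_funM ?mulrA.
  by rewrite -!exprS.
rewrite it !(exprAC _ _ m) (prim_expr_order zP) !expr1n.
exact: torus_fun1.
Qed.

Lemma torsion_classesE :
  torsion_classes (oct_aut F) m =
  [set` [fset conj_class (torus_exp (m - bc.1 - bc.2) bc.1 bc.2)
         | bc in partitions3 m]%fset]%classic.
Proof.
apply/seteqP; split=> K /=.
  move=> [[f ->] fm].
  have /fm/= f1 : conj_class f f by apply/conj_class_similar/similar_refl.
  have [bc bcP s] := similar_torus_exp f1.
  apply/imfsetP; exists bc => //=; exact/conj_classP.
move=> /imfsetP[[b c] /= bcP ->]; split; first by eexists.
move: bcP; rewrite mem_partitions3 => /andP[cb bm].
move=> f [g _ <-] /=; rewrite -conjXg torus_exp_order ?conj1g //.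
by rewrite (_ : m - b - c + b + c = m)%N //; lia.
Qed.

Lemma num_torsion_classesE : num_torsion_classes (oct_aut F) m = size (partitions3 m).
Proof.
rewrite /num_torsion_classes torsion_classesE set_fsetK.
rewrite card_in_imfset => [|bc bc' bcP bcP' /conj_classP].
  exact/congr1/undup_id/uniq_partitions3.
exact: partitions3_inj.
Qed.

Lemma finite_torsion_classes : finite_set (torsion_classes (oct_aut F) m).
Proof. rewrite torsion_classesE; exact: finite_fset. Qed.

End Counting.

Theorem theorem3p4 (R : realType) (m : nat) (m_gt0 : (0 < m)%N) :
  let N : rat := (num_torsion_classes (G2 R) m)%:R in
  let M : rat := m%:R in
  finite_set (torsion_classes (G2 R) m) /\
  [/\ (m = 0 %[mod 6])%N -> N = (M ^+ 2 + 6 * M + 12) / 12,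
      (m = 1 %[mod 6])%N \/ (m = 5 %[mod 6])%N ->
        N = (M ^+ 2 + 6 * M + 5) / 12,
      (m = 2 %[mod 6])%N \/ (m = 4 %[mod 6])%N ->
        N = (M ^+ 2 + 6 * M + 8) / 12
    & (m = 3 %[mod 6])%N -> N = (M ^+ 2 + 6 * M + 9) / 12].
Proof.
have [z zP] := prim_root_exists R[i] m_gt0.
have NE := num_torsion_classesE zP; have fin := finite_torsion_classes zP.
have formula (k : nat) : nth 0%N [:: 12; 5; 8; 9; 8; 5]%N (m %% 6) = k ->
    (num_torsion_classes (G2 R) m)%:R = ((m%:R ^+ 2 + 6 * m%:R + k%:R) / 12 : rat).
  move=> kE; apply: (canRL (mulfK _)) => //; rewrite mulrC.
  by rewrite /G2 NE -natrX -!natrM -!natrD size_partitions3E kE.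
split; first exact: fin.
by split=> [e|[]e|[]e|e]; apply: formula; rewrite e.
Qed.
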